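(* Let $m\ge4$, let $\mathcal W_1$ be an $m\times m$ quadrilateral labyrinth set in $Q$, and let $L_\infty$ be the associated quadrilateral labyrinth fractal. Then $Q\setminus L_\infty$ is not path connected.
   Context: Let $Q$ be a convex quadrilateral in $\mathbb{R}^2$. Divide $Q$ into two triangles by its shorter diagonal (either diagonal if they have equal length). Label the vertices $Q_1,Q_2,Q_3,Q_4$ anticlockwise, starting at an endpoint of that diagonal, so that the diagonal is $Q_1Q_3$. Let $\Delta_1$ be the closed triangle $Q_1Q_2Q_3$ and $\Delta_2$ the closed triangle $Q_3Q_4Q_1$. Every $x\in Q$ has a unique representation $x=\sum_{i=1}^4\alpha_iQ_i$, defined as follows. If $x\in\Delta_1$, then $\alpha_4=0$ and $(\alpha_1,\alpha_2,\alpha_3)$ are the barycentric coordinates of $x$ in $\Delta_1$. If $x\in\Delta_2$, then $\alpha_2=0$ and $(\alpha_1,\alpha_3,\alpha_4)$ are the barycentric coordinates of $x$ in $\Delta_2$. For an ordered quadruple $V=(V_1,\dots,V_4)$ define $P_V:Q\to\mathbb{R}^2$ by $P_V(x)=\sum_i\alpha_iV_i$. For an integer $m\ge2$, define the following index sets: - $A_1=\{(k_1,k_2,k_3,0)\in\mathbb{Z}_{\ge0}^4:k_1+k_2+k_3=m-1,\ k_2\ne0\}$, - $A_2=\{(k_1,0,k_3,k_4)\in\mathbb{Z}_{\ge0}^4:k_1+k_3+k_4=m-1,\ k_4\ne0\}$, - $A_3=\{(k_1,0,k_3,0)\in\mathbb{Z}_{\ge0}^4:k_1+k_3=m-1\}$,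 - $A=A_1\cup A_2\cup A_3$. For $k\in A$, let $S_m(k)$ be the quadrilateral with ordered vertices $R_1R_2R_3R_4$ given below. - If $k\in A_1$: $R_1=\frac{(k_1+1)Q_1+k_2Q_2+k_3Q_3}{m}$, $R_2=\frac{k_1Q_1+(k_2+1)Q_2+k_3Q_3}{m}$, $R_3=\frac{k_1Q_1+k_2Q_2+(k_3+1)Q_3}{m}$, $R_4=\frac{(k_1+1)Q_1+(k_2-1)Q_2+(k_3+1)Q_3}{m}$. - If $k\in A_2$: $R_1=\frac{(k_1+1)Q_1+k_3Q_3+k_4Q_4}{m}$, $R_2=\frac{(k_1+1)Q_1+(k_3+1)Q_3+(k_4-1)Q_4}{m}$, $R_3=\frac{k_1Q_1+(k_3+1)Q_3+k_4Q_4}{m}$, $R_4=\frac{k_1Q_1+k_3Q_3+(k_4+1)Q_4}{m}$. - If $k\in A_3$: $R_1=\frac{(k_1+1)Q_1+k_3Q_3}{m}$, $R_2=\frac{k_1Q_1+Q_2+k_3Q_3}{m}$, $R_3=\frac{k_1Q_1+(k_3+1)Q_3}{m}$, $R_4=\frac{k_1Q_1+k_3Q_3+Q_4}{m}$. Let $\mathcal S_m=\{S_m(k):k\in A\}$. For $\mathcal W\subseteq\mathcal S_m$, the graph $\mathcal G(\mathcal W)$ has vertex set $\mathcal W$, with two elements adjacent iff they have a common side. An $m\times m$ quadrilateral labyrinth set ($m\ge4$) is a set $\mathcal W_1\subseteq\mathcal S_m$ satisfying three properties. (1) Tree property: $\mathcal G(\mathcal W_1)$ is a tree. (2) Exit property: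 there is exactly one $(k_1,k_2,0,0)\in A$ with $S_m(k_1,k_2,0,0)\in\mathcal W_1$ and $S_m(0,0,k_2,k_1)\in\mathcal W_1$. There is also exactly one $(k_1,0,0,k_4)\in A$ with $S_m(k_1,0,0,k_4)\in\mathcal W_1$ and $S_m(0,k_1,k_4,0)\in\mathcal W_1$. (3) Corner property: $\mathcal W_1$ contains at most one element of $\{S_m(m-1,0,0,0),S_m(0,0,m-1,0)\}$ and at most one element of $\{S_m(0,m-1,0,0),S_m(0,0,0,m-1)\}$. Define recursively for $n\ge2$: $\mathcal W_n=\{P_{W}(W'):W'\in\mathcal W_1,\ W\in\mathcal W_{n-1}\}$. Here $P_W(W')$ is the quadrilateral whose ordered vertices are the images under $P_W$ of the ordered vertices of $W'$. Let $L_n=\bigcup_{W\in\mathcal W_n}W$ (closed regions) and $L_\infty=\bigcap_{n\ge1}L_n$. *)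

(* Defs.v *)
From mathcomp Require Import all_boot all_order all_algebra.
From mathcomp Require Import all_classical all_reals all_analysis.

Set Implicit Arguments.
Unset Strict Implicit.
Unset Printing Implicit Defensive.

Import Order.TTheory GRing.Theory Num.Theory numFieldNormedType.Exports.
Local Open Scope classical_set_scope.
Local Open Scope ring_scope.

Section Labyrinth.
Variable R : realType.

Definition pt := (R * R)%type.

Record quad := Quad { qv1 : pt; qv2 : pt; qv3 : pt; qv4 : pt }.

Definition comb4 (a1 a2 a3 a4 : R) (V : quad) : pt :=
  (a1 * (qv1 V).1 + a2 * (qv2 V).1 + a3 * (qv3 V).1 + a4 * (qv4 V).1,
   a1 * (qv1 V).2 + a2 * (qv2 V).2 + a3 * (qv3 V).2 + a4 * (qv4 V).2).

Definition orient (a b c : pt) : R :=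
  (b.1 - a.1) * (c.2 - a.2) - (b.2 - a.2) * (c.1 - a.1).

Definition sqdist (a b : pt) : R := (a.1 - b.1) ^+ 2 + (a.2 - b.2) ^+ 2.

(* Q1 Q2 Q3 Q4 are the vertices, in anticlockwise order, of a (strictly)
   convex quadrilateral: every consecutive triple makes a left turn. *)
Definition convex_quad_ccw (Q : quad) : Prop :=
  0 < orient (qv1 Q) (qv2 Q) (qv3 Q) /\ 0 < orient (qv2 Q) (qv3 Q) (qv4 Q) /\
  0 < orient (qv3 Q) (qv4 Q) (qv1 Q) /\ 0 < orient (qv4 Q) (qv1 Q) (qv2 Q).

Definition shorter_diag13 (Q : quad) : Prop :=
  sqdist (qv1 Q) (qv3 Q) <= sqdist (qv2 Q) (qv4 Q).

Definition region (W : quad) : set pt :=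
  [set x | exists b1 b2 b3 b4 : R, 0 <= b1 /\ 0 <= b2 /\ 0 <= b3 /\ 0 <= b4 /\
     b1 + b2 + b3 + b4 = 1 /\ x = comb4 b1 b2 b3 b4 W].

(* (a1,a2,a3,a4) is THE representation of x in Q: barycentric coordinates
   in Delta1 = Q1Q2Q3 (a4 = 0) if x is in Delta1, and otherwise in
   Delta2 = Q3Q4Q1 (a2 = 0).  (On the common side Q1Q3 both coincide.) *)
Definition qrep (Q : quad) (a1 a2 a3 a4 : R) (x : pt) : Prop :=
  ((a4 = 0 /\ 0 <= a1 /\ 0 <= a2 /\ 0 <= a3 /\ a1 + a2 + a3 = 1 /\
    x = comb4 a1 a2 a3 0 Q)
   \/
   (~ (exists b1 b2 b3 : R, 0 <= b1 /\ 0 <= b2 /\ 0 <= b3 /\ b1 + b2 + b3 = 1 /\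
        x = comb4 b1 b2 b3 0 Q) /\
    a2 = 0 /\ 0 <= a1 /\ 0 <= a3 /\ 0 <= a4 /\ a1 + a3 + a4 = 1 /\
    x = comb4 a1 0 a3 a4 Q)).

Definition Pmap (Q V : quad) (x y : pt) : Prop :=
  exists a1 a2 a3 a4 : R, qrep Q a1 a2 a3 a4 x /\ y = comb4 a1 a2 a3 a4 V.

Definition Pquad (Q V W' W : quad) : Prop :=
  Pmap Q V (qv1 W') (qv1 W) /\ Pmap Q V (qv2 W') (qv2 W) /\
  Pmap Q V (qv3 W') (qv3 W) /\ Pmap Q V (qv4 W') (qv4 W).

Definition idx := (nat * nat * nat * nat)%type.
Definition k1 (k : idx) := k.1.1.1.
Definition k2 (k : idx) := k.1.1.2.
Definition k3 (k : idx) := k.1.2.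
Definition k4 (k : idx) := k.2.

Definition inA1 (m : nat) (k : idx) : Prop :=
  k4 k = 0%N /\ (k1 k + k2 k + k3 k = m - 1)%N /\ k2 k <> 0%N.
Definition inA2 (m : nat) (k : idx) : Prop :=
  k2 k = 0%N /\ (k1 k + k3 k + k4 k = m - 1)%N /\ k4 k <> 0%N.
Definition inA3 (m : nat) (k : idx) : Prop :=
  k2 k = 0%N /\ k4 k = 0%N /\ (k1 k + k3 k = m - 1)%N.
Definition inA (m : nat) (k : idx) : Prop := inA1 m k \/ inA2 m k \/ inA3 m k.

(* the quadrilateral S_m(k); the case split matches A_1 / A_2 / A_3,
   which are pairwise disjoint (k2 <> 0, resp. k2 = 0 and k4 <> 0,
   resp. k2 = k4 = 0). *)
Definition Sm (Q : quad) (m : nat) (k : idx) : quad :=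
  let c1 := (k1 k)%:R in let c2 := (k2 k)%:R in
  let c3 := (k3 k)%:R in let c4 := (k4 k)%:R in
  let mm := (m%:R : R) in
  if (k2 k != 0)%N then
    Quad (comb4 ((c1 + 1) / mm) (c2 / mm) (c3 / mm) 0 Q)
         (comb4 (c1 / mm) ((c2 + 1) / mm) (c3 / mm) 0 Q)
         (comb4 (c1 / mm) (c2 / mm) ((c3 + 1) / mm) 0 Q)
         (comb4 ((c1 + 1) / mm) ((c2 - 1) / mm) ((c3 + 1) / mm) 0 Q)
  else if (k4 k != 0)%N then
    Quad (comb4 ((c1 + 1) / mm) 0 (c3 / mm) (c4 / mm) Q)
         (comb4 ((c1 + 1) / mm) 0 ((c3 + 1) / mm) ((c4 - 1) / mm) Q)
         (comb4 (c1 / mm) 0 ((c3 + 1) / mm) (c4 / mm) Q)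
         (comb4 (c1 / mm) 0 (c3 / mm) ((c4 + 1) / mm) Q)
  else
    Quad (comb4 ((c1 + 1) / mm) 0 (c3 / mm) 0 Q)
         (comb4 (c1 / mm) (1 / mm) (c3 / mm) 0 Q)
         (comb4 (c1 / mm) 0 ((c3 + 1) / mm) 0 Q)
         (comb4 (c1 / mm) 0 (c3 / mm) (1 / mm) Q).

Definition Sset (Q : quad) (m : nat) : set quad :=
  [set W | exists k, inA m k /\ W = Sm Q m k].

Definition is_side (W : quad) (a b : pt) : Prop :=
  (a = qv1 W /\ b = qv2 W) \/ (a = qv2 W /\ b = qv3 W) \/
  (a = qv3 W /\ b = qv4 W) \/ (a = qv4 W /\ b = qv1 W).

Definition common_side (W W' : quad) : Prop :=
  W <> W' /\
  exists a b, is_side W a b /\ (is_side W' a b \/ is_side W' b a).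

Definition graph_connected (T : Type) (V : set T) (adj : T -> T -> Prop) :=
  forall u v, V u -> V v -> exists (n : nat) (p : nat -> T),
    p 0%N = u /\ p n = v /\ (forall i, (i <= n)%N -> V (p i)) /\
    (forall i, (i < n)%N -> adj (p i) (p i.+1)).

Definition graph_has_cycle (T : Type) (V : set T) (adj : T -> T -> Prop) :=
  exists (n : nat) (p : nat -> T), (3 <= n)%N /\
    (forall i, (i < n)%N -> V (p i)) /\
    (forall i j, (i < n)%N -> (j < n)%N -> p i = p j -> i = j) /\
    (forall i, (i.+1 < n)%N -> adj (p i) (p i.+1)) /\
    adj (p n.-1) (p 0%N).

Definition is_tree (T : Type) (V : set T) (adj : T -> T -> Prop) :=
  (exists v, V v) /\ graph_connected V adj /\ ~ graph_has_cycle V adj.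

Definition mk4 (a b c d : nat) : idx := (a, b, c, d).

Definition labyrinth_set (Q : quad) (m : nat) (W1 : set quad) : Prop :=
  (4 <= m)%N /\
  W1 `<=` Sset Q m /\
  is_tree W1 common_side /\
  (exists a b : nat,
     (inA m (mk4 a b 0 0) /\ W1 (Sm Q m (mk4 a b 0 0)) /\
      W1 (Sm Q m (mk4 0 0 b a))) /\
     forall a' b' : nat,
       inA m (mk4 a' b' 0 0) /\ W1 (Sm Q m (mk4 a' b' 0 0)) /\
       W1 (Sm Q m (mk4 0 0 b' a')) -> a' = a /\ b' = b) /\
  (exists a d : nat,
     (inA m (mk4 a 0 0 d) /\ W1 (Sm Q m (mk4 a 0 0 d)) /\
      W1 (Sm Q m (mk4 0 a d 0))) /\
     forall a' d' : nat,
       inA m (mk4 a' 0 0 d') /\ W1 (Sm Q m (mk4 a' 0 0 d')) /\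
       W1 (Sm Q m (mk4 0 a' d' 0)) -> a' = a /\ d' = d) /\
  ~ (W1 (Sm Q m (mk4 m.-1 0 0 0)) /\ W1 (Sm Q m (mk4 0 0 m.-1 0))) /\
  ~ (W1 (Sm Q m (mk4 0 m.-1 0 0)) /\ W1 (Sm Q m (mk4 0 0 0 m.-1))).

(* Wset Q W1 n = W_{n+1} *)
Fixpoint Wset (Q : quad) (W1 : set quad) (n : nat) : set quad :=
  match n with
  | 0%N => W1
  | n'.+1 => [set W | exists W' V, W1 W' /\ Wset Q W1 n' V /\ Pquad Q V W' W]
  end.

Definition Lset (Q : quad) (W1 : set quad) (n : nat) : set pt :=
  \bigcup_(W in Wset Q W1 n) region W.

Definition Linf (Q : quad) (W1 : set quad) : set pt :=
  \bigcap_(n in [set: nat]) Lset Q W1 n.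

Definition path_connected (A : set pt) : Prop :=
  forall x y, A x -> A y -> exists f : R -> pt,
    {within `[0, 1], continuous f} /\ f 0 = x /\ f 1 = y /\
    f @` `[0, 1] `<=` A.

End Labyrinth.

(* Main.v *)
Require Import Defs.
From mathcomp Require Import all_boot all_order all_algebra.
From mathcomp Require Import all_classical all_reals all_analysis.
From mathcomp Require Import zify ring lra.
Import Order.TTheory GRing.Theory Num.Theory numFieldNormedType.Exports.
Local Open Scope classical_set_scope.
Local Open Scope ring_scope.

(* A piecewise affine homeomorphism from the unit square onto Q carries the
   squares of the m^n x m^n grid onto the level-n quadrilaterals, so the fractal
   becomes a self-similar set of grid squares. Since the pattern is connected
   and has matching exits, the level-n squares always contain an edge-connected
   walk from bottom to top and one from left to right. Colouring each remaining
   square by the parity of the crossings of a ray with such a walk, touching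
   squares get the same colour while the two opposite sides of the grid get
   different ones; hence a connected set joining these sides meets every L_n and,
   if compact, also their intersection. By the corner property two vertices of
   Q with a common side lie outside the fractal, and no path avoids it. *)

(** * Walks on the grid *)

Section GridWalks.
Local Open Scope nat_scope.
Local Set Implicit Arguments.
Local Unset Strict Implicit.

Definition cellidx := (nat * nat)%type.

Definition adj4 (p q : cellidx) : bool :=
  (p.1 == q.1) && ((p.2 == q.2.+1) || (q.2 == p.2.+1)) ||
  (p.2 == q.2) && ((p.1 == q.1.+1) || (q.1 == p.1.+1)).

(* A step p, q of a walk meets the leftward ray from (i, j) at height j + 1/2; the
   parity of the number of such steps separates the two sides of the walk. *)
Definition crosses (i j : nat) (p q : cellidx) : bool :=
  [&& p.1 < i, q.1 < i & (p.2 <= j) (+) (q.2 <= j)].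

Fixpoint parity (f : cellidx -> cellidx -> bool) (p : cellidx) (s : seq cellidx) :=
  if s is q :: s' then f p q (+) parity f q s' else false.

Lemma parity_addb f g p s :
  parity (fun p q => f p q (+) g p q) p s = parity f p s (+) parity g p s.
Proof. by elim: s p => //= q s IH p; rewrite IH -!addbA; congr addb; rewrite addbCA. Qed.

(** A telescoping sum modulo 2: each inner cell of the walk contributes twice. *)
Lemma parity_coboundary (S : pred cellidx) p s :
  parity (fun p q => S p (+) S q) p s = S p (+) S (last p s).
Proof.
elim: s p => [|q s IH] p /=; first by rewrite addbb.
by rewrite IH addbA -(addbA (S p)) addbb addbF.
Qed.

(** Reduces a comparison of crossing numbers to single steps. The predicate [P] records what is
    known of all cells of the walk, typically that they avoid a given cell. *)
Lemma eq_parity (P : pred cellidx) f g p s :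
  (forall p q, adj4 p q -> P p -> P q -> f p q = g p q) ->
  path adj4 p s -> all P (p :: s) -> parity f p s = parity g p s.
Proof.
move=> fg; elim: s p => //= q s IH p /andP[pq qs] /and3P[Pp Pq Ps].
by rewrite fg // IH //= Pq.
Qed.

(** * Crossing parity relative to a fixed walk *)

Section Colour.
Variables (p0 : cellidx) (s : seq cellidx).
Hypothesis walk_s : path adj4 p0 s.

Definition colour (i j : nat) : bool := parity (crosses i j) p0 s.

Let offwalk (c : cellidx) (c_off : c \notin p0 :: s) :
  all (fun p => p != c) (p0 :: s).
Proof. by apply/allP => p ps; apply: contraNneq c_off => <-. Qed.

Lemma colour0 j : colour 0 j = false.
Proof.
rewrite /colour (@eq_parity predT _ (fun _ _ => false)) ?all_predT //.
by elim: s p0 => //= ? ? IH ?; rewrite IH.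
Qed.

(** The two counts differ only by vertical steps between (i, j) and (i, j+1), and such a step uses
    both cells. *)
Lemma colour_right i j :
  ((i, j) \notin p0 :: s) || ((i, j.+1) \notin p0 :: s) ->
  colour i.+1 j = colour i j.
Proof.
by case/orP => /offwalk off; apply: (eq_parity _ walk_s off) => // -[a b] [c d];
  rewrite /crosses /adj4 /= !xpair_eqE; lia.
Qed.

(** The crossings of the two rays together count the steps entering or leaving the part of row j+1
    to the left of column i (the set [S]). A horizontal step across its right end would use the
    excluded cell (i, j+1). Both endpoints of the walk lie outside this row, so the total is
    even. *)
Lemma colour_up i j :
  (i, j.+1) \notin p0 :: s -> p0.2 <= j -> j.+1 < (last p0 s).2 ->
  colour i j.+1 = colour i j.
Proof.
move=> /offwalk off lo hi.
pose S (p : cellidx) := (p.2 == j.+1) && (p.1 < i).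
have: parity (fun p q => crosses i j.+1 p q (+) crosses i j p q) p0 s =
      parity (fun p q => S p (+) S q) p0 s.
  apply: (eq_parity _ walk_s off) => // -[a b] [c d].
  by rewrite /crosses /S /adj4 /= !xpair_eqE; lia.
rewrite parity_addb parity_coboundary -/(colour i j.+1) -/(colour i j).
have -> : S p0 = false by rewrite /S ltn_eqF.
have -> : S (last p0 s) = false by rewrite /S gtn_eqF.
by case: colour; case: colour.
Qed.

(** No cell of the walk lies beyond column i, and a crossing inside column i would use the cell (i,
    j). So every crossing of height j + 1/2 is counted, and their number is odd since the walk
    starts below this height and ends above it. *)
Lemma colour_last i j :
  (i, j) \notin p0 :: s -> all (fun p => p.1 <= i) (p0 :: s) ->
  p0.2 <= j -> j < (last p0 s).2 -> colour i j = true.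
Proof.
move=> /offwalk off le_i lo hi.
rewrite /colour.
rewrite (@eq_parity (fun p => (p != (i, j)) && (p.1 <= i)) _
           (fun p q => (p.2 <= j) (+) (q.2 <= j))) //.
- by rewrite (parity_coboundary (fun p => p.2 <= j)) lo leqNgt hi.
- by move=> [a b] [c d]; rewrite /crosses /adj4 /= !xpair_eqE; lia.
- by rewrite all_predI off le_i.
Qed.


(** With j <= j', go along row j to column i' and then up. At a diagonal contact the intermediate
    cell (i', j) may lie on the walk, which is why [colour_right] asks for only one of two cells to
    be off it. *)
Lemma colour_adj8 N i j i' j' :
  p0.2 = 0 -> (last p0 s).2 = N -> j < N -> j' < N ->
  i <= i'.+1 -> i' <= i.+1 -> j <= j'.+1 -> j' <= j.+1 ->
  (i, j) \notin p0 :: s -> (i', j') \notin p0 :: s -> colour i j = colour i' j'.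
Proof.
move=> start0 lastN.
wlog jj' : i j i' j' / j <= j'.
  move=> H ltj ltj' ii' i'i jj' j'j off off'.
  by case: (leqP j j') => [|/ltnW] le_j; [|symmetry]; exact: H.
move=> ltj ltj' ii' i'i _ j'j off off'.
have up : colour i' j = colour i' j'.
  have [ejj'|nejj'] := eqVneq j j'; first by rewrite ejj'.
  have ej' : j' = j.+1 by lia.
  by subst j'; rewrite colour_up ?start0 ?lastN.
rewrite -up.
have [eii'|neii'] := eqVneq i i'; first by rewrite eii'.
have rowj : (i', j) \notin p0 :: s \/ (i', j.+1) \notin p0 :: s.
  have [ejj'|nejj'] := eqVneq j j'; first by left; rewrite ejj'.
  by right; have <- : j' = j.+1 by lia.
have [ltii'|ltii'] := ltnP i i'.
  have -> : i' = i.+1 by lia.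
  by rewrite colour_right // off.
have -> : i = i'.+1 by lia.
by rewrite colour_right //; apply/orP.
Qed.

End Colour.

Definition walk (G : pred cellidx) (a b : cellidx) :=
  exists s, [/\ path adj4 a s, last a s = b & all G (a :: s)].

Lemma walk_cat G a b c : walk G a b -> walk G b c -> walk G a c.
Proof.
move=> [s [ps <- Gs]] [t [pt <- Gt]]; exists (s ++ t).
rewrite cat_path ps pt last_cat; split => //.
by rewrite -cat_cons all_cat Gs; case/andP: Gt.
Qed.

Lemma walk_step (G : pred cellidx) a b : G a -> G b -> adj4 a b -> walk G a b.
Proof. by move=> Ga Gb ab; exists [:: b]; rewrite /= ab Ga Gb. Qed.

Lemma walk_map (G H : pred cellidx) (f : cellidx -> cellidx) a b :
  (forall p q, adj4 p q -> adj4 (f p) (f q)) -> (forall p, G p -> H (f p)) ->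
  walk G a b -> walk H (f a) (f b).
Proof.
move=> adjf GH [s [ps <- Gs]]; exists (map f s); rewrite last_map; split=> //.
  by elim: s a ps {Gs} => //= q s IH a /andP[/adjf -> /IH].
by rewrite -map_cons all_map; apply/allP => p /(allP Gs)/GH.
Qed.

Lemma walk_swap G a b :
  walk G a b -> walk (fun c => G (c.2, c.1)) (a.2, a.1) (b.2, b.1).
Proof.
apply: (@walk_map G (fun c => G (c.2, c.1)) (fun c => (c.2, c.1))).
  by move=> p q; rewrite /adj4 /= orbC.
by case.
Qed.

(** * Substitution patterns: each cell is replaced by a copy of [H] *)

Section Substitution.
Variables (m : nat) (H : pred cellidx) (b d : nat).
Hypothesis ltH : forall c, H c -> c.1 < m /\ c.2 < m.
Hypothesis connH : forall p q, H p -> H q -> walk H p q.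
Hypothesis bottom_exit : H (b, 0).
Hypothesis top_exit : H (b, m.-1).
Hypothesis left_exit : H (0, d).
Hypothesis right_exit : H (m.-1, d).

Fixpoint pattern (n : nat) : pred cellidx :=
  if n is n'.+1 then
    fun c => pattern n' (c.1 %/ m, c.2 %/ m) && H (c.1 %% m, c.2 %% m)
  else H.

Definition subcell (C p : cellidx) : cellidx := (C.1 * m + p.1, C.2 * m + p.2).

Lemma m_gt0 : 0 < m. Proof. by have [/(leq_ltn_trans _)->] := ltH bottom_exit. Qed.

Lemma pattern_subcell n C p : pattern n C -> H p -> pattern n.+1 (subcell C p).
Proof.
case: C p => [i j] [i' j'] GC Hp /=; have [/= ltp ltp'] := ltH Hp.
by rewrite !divnMDl ?m_gt0 // !divn_small // !addn0 GC !modnMDl !modn_small.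
Qed.

Lemma pattern_subcellE n c : pattern n.+1 c ->
  exists C p, [/\ pattern n C, H p & c = subcell C p].
Proof.
case: c => i j /andP[GC Hp]; exists (i %/ m, j %/ m), (i %% m, j %% m); split => //.
by rewrite /subcell /= -!divn_eq.
Qed.

Lemma pattern_lt n c : pattern n c -> c.1 < m ^ n.+1 /\ c.2 < m ^ n.+1.
Proof.
elim: n c => [|n IH] c; first by rewrite expn1; exact: ltH.
move=> /andP[/IH[/= lt1 lt2] _]; rewrite expnSr.
by rewrite -!ltn_divLR ?m_gt0.
Qed.

(** A walk through coarse blocks is refined block by block. Each block is a connected copy of [H],
    and consecutive blocks are joined through matching exits. *)
Lemma pattern_connected n p q : pattern n p -> pattern n q -> walk (pattern n) p q.
Proof.
elim: n p q => [|n IH] p q; first exact: connH.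
move=> /pattern_subcellE[C [p' [GC Hp' ->]]] /pattern_subcellE[D [q' [GD Hq' ->]]].
have inside E x y : pattern n E -> H x -> H y ->
    walk (pattern n.+1) (subcell E x) (subcell E y).
  move=> GE Hx Hy; apply: (@walk_map H _ (subcell E)); last exact: connH.
    by move=> u v; rewrite /adj4 /subcell /= -!addnS !eqn_add2l.
  by move=> u Hu; exact: pattern_subcell.
have [s [ps lasts Gs]] := IH C D GC GD.
elim: s C p' ps lasts Gs GC Hp' => [|E s IHs] C p' /=.
  by move=> _ -> _ GC Hp'; exact: inside.
move=> /andP[CE ps] lasts /and3P[_ GE Gs] GC Hp'.
(* The four cases are the positions of [E] relative to [C]: below, above, left, right. Vertical
   neighbours meet in column [b], horizontal ones in row [d]. *)
have [x [y [Hx Hy xy]]] : exists x y, [/\ H x, H y & adj4 (subcell C x) (subcell E y)].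
  have m0 := m_gt0; move: CE; rewrite /adj4 /subcell => /orP[] /andP[/eqP e /orP[] /eqP e'].
  - exists (b, 0), (b, m.-1); split=> //=; apply/orP; left.
    by rewrite e e' mulSn addn0 -(addnS _ m.-1) prednK // (addnC m) !eqxx.
  - exists (b, m.-1), (b, 0); split=> //=; apply/orP; left.
    by rewrite e e' mulSn addn0 -(addnS _ m.-1) prednK // (addnC m) !eqxx orbT.
  - exists (0, d), (m.-1, d); split=> //=; apply/orP; right.
    by rewrite e e' mulSn addn0 -(addnS _ m.-1) prednK // (addnC m) !eqxx.
  - exists (m.-1, d), (0, d); split=> //=; apply/orP; right.
    by rewrite e e' mulSn addn0 -(addnS _ m.-1) prednK // (addnC m) !eqxx orbT.
apply: walk_cat (inside C p' x GC Hp' Hx) _.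
apply: walk_cat (walk_step _ _ xy) _; try exact: pattern_subcell.
by apply: IHs => //=; rewrite GE Gs.
Qed.

Lemma pattern_bottom n : exists x, pattern n (x, 0).
Proof.
elim: n => [|n [x IH]]; first by exists b.
by exists (x * m + b); exact: (pattern_subcell IH bottom_exit).
Qed.

Lemma pattern_left n : exists y, pattern n (0, y).
Proof.
elim: n => [|n [y IH]]; first by exists d.
by exists (y * m + d); exact: (pattern_subcell IH left_exit).
Qed.

Lemma last_subcell n : (m ^ n.+1).-1 * m + m.-1 = (m ^ n.+2).-1.
Proof.
have m0 := m_gt0; have : 0 < m ^ n.+1 by rewrite expn_gt0 m0.
by rewrite (expnSr m n.+1); case: (m ^ n.+1) => // k _; rewrite /= mulSnr -(subn1 m) -(subn1 (_ + _)) addnBA.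
Qed.

Lemma pattern_top n : exists x, pattern n (x, (m ^ n.+1).-1).
Proof.
elim: n => [|n [x IH]]; first by exists b; rewrite expn1.
exists (x * m + b); rewrite -last_subcell; exact: (pattern_subcell IH top_exit).
Qed.

Lemma pattern_right n : exists y, pattern n ((m ^ n.+1).-1, y).
Proof.
elim: n => [|n [y IH]]; first by exists d; rewrite expn1.
exists (y * m + d); rewrite -last_subcell; exact: (pattern_subcell IH right_exit).
Qed.

End Substitution.
End GridWalks.

(** * Connected sets and grid squares *)

Section Separation.
Local Set Implicit Arguments.
Local Unset Strict Implicit.

(** Choose a point of K in each C n. A cluster point of this sequence in K lies in every C n,
    because C n is closed and contains a tail. *)
Lemma compact_nested (T : topologicalType) (K : set T) (C : nat -> set T) :
  compact K -> (forall n, closed (C n)) -> (forall n, C n.+1 `<=` C n) ->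
  (forall n, K `&` C n !=set0) -> K `&` \bigcap_n C n !=set0.
Proof.
move=> cK cC decC ne.
have decr n k : (n <= k)%N -> C k `<=` C n.
  move=> /subnK <-; elim: (k - n)%N => [//|i IH].
  by apply: subset_trans IH; rewrite addSn; exact: decC.
have [x Hx] := choice ne.
have [|p [Kp clp]] := cK (x @ \oo) _.
  by exists 0%N => // k _; case: (Hx k).
exists p; split => // n _; rewrite (closure_id (C n)).1 // => B nB.
by apply: clp => //; exists n => // k /= nk; apply: decr nk _ _; case: (Hx k).
Qed.

Variable R : realType.

(** The squares are closed, so a point may lie in up to four of them; colours must therefore agree
    on all squares that touch, even at a corner. *)
Definition gridsquare (N : nat) (c : cellidx) (s t : R) : Prop :=
  c.1%:R / N%:R <= s <= c.1.+1%:R / N%:R /\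
  c.2%:R / N%:R <= t <= c.2.+1%:R / N%:R.

Lemma gridsquare_swap N c s t :
  gridsquare N c s t -> gridsquare N (c.2, c.1) t s.
Proof. by case. Qed.

Lemma grid_index N (s : R) : (0 < N)%N -> 0 <= s <= 1 ->
  exists2 i, (i < N)%N & i%:R / N%:R <= s <= i.+1%:R / N%:R.
Proof.
move=> N0 /andP[s0 s1]; have N0' : 0 < N%:R :> R by rewrite ltr0n.
have [sN|sN] := ltP s 1; last first.
  (* At s = 1 truncation would give the index N, which is out of range; the last interval is taken
     instead. *)
  exists N.-1; rewrite ?prednK // divff ?gt_eqF // s1 andbT.
  by apply: le_trans sN; rewrite ler_pdivrMr // mul1r ler_nat leq_pred.
have sN0 : 0 <= s * N%:R by rewrite mulr_ge0 // ltW.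
have /andP[lo hi] := truncn_itv sN0.
exists (Num.truncn (s * N%:R)).
  by rewrite -(ltr_nat R); apply: le_lt_trans lo _; rewrite gtr_pMl.
by rewrite ler_pdivrMr // lo ler_pdivlMr // ltW.
Qed.

Lemma gridsquare_adj8 N c c' s t : (0 < N)%N ->
  gridsquare N c s t -> gridsquare N c' s t ->
  [/\ (c.1 <= c'.1.+1)%N, (c'.1 <= c.1.+1)%N, (c.2 <= c'.2.+1)%N & (c'.2 <= c.2.+1)%N].
Proof.
move=> N0 [/andP[a1 a2] /andP[b1 b2]] [/andP[a1' a2'] /andP[b1' b2']].
have N0' : 0 < (N%:R : R)^-1 by rewrite invr_gt0 ltr0n.
have le x y z : (x%:R / N%:R <= z :> R) -> (z <= y%:R / N%:R :> R) -> (x <= y)%N.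
  by move=> xz zy; have := le_trans xz zy; rewrite ler_pM2r // ler_nat.
by split; [exact: le a1 a2'|exact: le a1' a2|exact: le b1 b2'|exact: le b1' b2].
Qed.

Section Hits.
Variables (T : topologicalType) (u v : T -> R).
Hypotheses (cu : continuous u) (cv : continuous v).

Lemma closed_gridsquares N (P : pred cellidx) :
  closed [set x | exists c, [/\ (c.1 < N)%N, (c.2 < N)%N, P c & gridsquare N c (u x) (v x)]].
Proof.
pose I := [set c : cellidx | (c.1 < N)%N /\ (c.2 < N)%N /\ P c].
have -> : [set x | exists c, [/\ (c.1 < N)%N, (c.2 < N)%N, P c & gridsquare N c (u x) (v x)]] =
    \bigcup_(c in I) [set x | gridsquare N c (u x) (v x)].
  apply/seteqP; split => x /=.
    by move=> [c [c1 c2 Pc xc]]; exists c.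
  by move=> [c [c1 [c2 Pc]] xc]; exists c.
apply: closed_bigcup.
  apply: (@sub_finite_set _ _ (`I_N `*` `I_N)); last exact: finite_setX.
  by move=> [i j] [/= ? []].
move=> c _.
have cl (f : T -> R) a b : continuous f -> closed [set x | a <= f x <= b].
  move=> cf; rewrite (_ : [set x | _] = f @^-1` `[a, b]).
    by apply: preimage_closed => //; exact: interval_closed.
  by apply/seteqP; split => x /=; rewrite in_itv.
by apply: closedI; exact: cl.
Qed.

(** If K missed all squares of [G], every point of K would lie only in squares off the walk, whose
    common colour splits K into two disjoint closed parts, one meeting u = 0 and the other u = 1. *)
Lemma connected_meets_walk (N : nat) (G : pred cellidx) (x y : nat) (K : set T) :
  (0 < N)%N -> (forall c, G c -> (c.1 < N)%N /\ (c.2 < N)%N) ->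
  walk G (x, 0%N) (y, N.-1) -> connected K ->
  (forall z, K z -> 0 <= u z <= 1 /\ 0 <= v z <= 1) ->
  (exists2 z, K z & u z = 0) -> (exists2 z, K z & u z = 1) ->
  exists2 z, K z & exists2 c, G c & gridsquare N c (u z) (v z).
Proof.
move=> N0 ltG [s [ps lasts Gs]] connK unitK [z0 Kz0 uz0] [z1 Kz1 uz1].
apply: contrapT => noG.
(* One extra step above the top row makes the walk cross every horizontal level. *)
pose w := rcons s (y, N).
have pw : path adj4 (x, 0%N) w.
  by rewrite rcons_path ps lasts /adj4 /= prednK // !eqxx orbT.
have lastw : last (x, 0%N) w = (y, N) by rewrite last_rcons.
have off z c : K z -> (c.2 < N)%N -> gridsquare N c (u z) (v z) -> c \notin (x, 0%N) :: w.
  move=> Kz c2 zc; rewrite -rcons_cons mem_rcons inE negb_or; apply/andP; split.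
    by apply: contraTneq c2 => -> /=; rewrite ltnn.
  by apply/negP => /(allP Gs) Gc; apply: noG; exists z => //; exists c.
have le_w : all (fun p : cellidx => p.1 <= N.-1)%N ((x, 0%N) :: w).
  have le_s : all (fun p : cellidx => p.1 <= N.-1)%N ((x, 0%N) :: s).
    by apply/allP => p /(allP Gs)/ltG[p1 _]; rewrite -ltnS prednK.
  have ley : (y <= N.-1)%N by have := allP le_s _ (mem_last (x, 0%N) s); rewrite lasts.
  by rewrite /w -rcons_cons all_rcons le_s andbT.
pose side b := [set z | exists c, [/\ (c.1 < N)%N, (c.2 < N)%N,
  colour (x, 0%N) w c.1 c.2 == b & gridsquare N c (u z) (v z)]].
have cl_side b : closed (side b).
  exact: (@closed_gridsquares N (fun c => colour (x, 0%N) w c.1 c.2 == b)).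
have cover z : K z -> side true z \/ side false z.
  move=> /unitK[uz vz]; have [i iN ui] := grid_index N0 uz.
  have [j jN vj] := grid_index N0 vz.
  by case E : (colour (x, 0%N) w i j); [left|right]; exists (i, j); rewrite /= E.
have disj z : K z -> side true z -> side false z -> False.
  move=> Kz [c [c1 c2 /eqP cT zc]] [c' [c1' c2' /eqP cF zc']].
  have [n1 n2 n3 n4] := gridsquare_adj8 N0 zc zc'.
  move: (off z c Kz c2 zc) (off z c' Kz c2' zc').
  move: c c' {zc zc'} c1 c2 c1' c2' cT cF n1 n2 n3 n4.
  move=> [i j] [i' j'] /= c1 c2 c1' c2' cT cF n1 n2 n3 n4 offc offc'.
  have := @colour_adj8 _ _ pw N i j i' j'; rewrite lastw cT cF => same.
  by have := same erefl erefl c2 c2' n1 n2 n3 n4 offc offc'.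
have left0 : side false z0.
  have [_ vz] := unitK _ Kz0; have [j jN vj] := grid_index N0 vz.
  exists (0%N, j); split => //=; first by rewrite colour0.
  by split => //=; rewrite uz0 mul0r lexx divr_ge0.
have right1 : side true z1.
  have [_ vz] := unitK _ Kz1; have [j jN vj] := grid_index N0 vz.
  have sq : gridsquare N (N.-1, j) (u z1) (v z1).
    split => //=; rewrite uz1 prednK // divff ?pnatr_eq0 -?lt0n // lexx andbT.
    by rewrite ler_pdivrMr ?ltr0n // mul1r ler_nat leq_pred.
  exists (N.-1, j); split => //=; first by rewrite prednK.
  by rewrite (colour_last pw) ?lastw //; exact: off sq.
(* In K the set [side false] is the complement of the closed set [side true], so it is both
   relatively open and relatively closed. *)
have KsideF : K `&` side false = K.
  apply: connK.
  - by exists z0.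
  - exists (~` side true); first by rewrite openC.
    apply/seteqP; split => z [Kz Sz]; split => //; last by case: (cover z Kz).
    by move=> Tz; exact: disj Tz Sz.
  - by exists (side false).
have [_ F1] : (K `&` side false) z1 by rewrite KsideF.
exact: disj right1 F1.
Qed.

End Hits.
End Separation.

(** * The quadrilateral as an image of the square *)

Section Geometry.
Local Set Implicit Arguments.
Local Unset Strict Implicit.
Variable R : realType.
Implicit Types (Q V W : quad R) (s t : R).

(* [psi Q] maps the unit square onto Q, affinely on each half of the square; the
   paper's P_V is [psi Q s t |-> psi V s t]. *)
Definition psi V s t : pt R :=
  if t <= s then comb4 (1 - s) (s - t) t 0 V else comb4 (1 - t) 0 s (t - s) V.

Lemma psi_low V s t : t <= s -> psi V s t = comb4 (1 - s) (s - t) t 0 V.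
Proof. by rewrite /psi => ->. Qed.

Lemma psi_up V s t : s <= t -> psi V s t = comb4 (1 - t) 0 s (t - s) V.
Proof.
rewrite /psi => st; case: ifP => // ts.
by have -> : s = t by [apply/eqP; rewrite eq_le st ts]; rewrite !subrr.
Qed.

Definition cell Q (N : nat) (c : cellidx) : quad R :=
  let x := c.1%:R / N%:R in let x' := c.1.+1%:R / N%:R in
  let y := c.2%:R / N%:R in let y' := c.2.+1%:R / N%:R in
  Quad (psi Q x y) (psi Q x' y) (psi Q x' y') (psi Q x y').

(** A cell off the main diagonal lies in one half of the square, where [psi Q] is affine. A cell on
    the diagonal is cut by it just as Q is cut by Q1Q3, so the two affine pieces match. *)
Lemma psi_cell Q N c s t : 0 <= s <= 1 -> 0 <= t <= 1 ->
  psi (cell Q N c) s t = psi Q ((c.1%:R + s) / N%:R) ((c.2%:R + t) / N%:R).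
Proof.
case: c => i j /andP[s0 s1] /andP[t0 t1] /=.
have N0 : 0 <= (N%:R : R)^-1 by rewrite invr_ge0.
have le a b : (a <= b)%N -> (a%:R / N%:R <= b%:R / N%:R :> R).
  by move=> ab; rewrite ler_wpM2r // ler_nat.
case: (ltngtP i j) => [ij|ji|->{i}].
- have ij' : i%:R + 1 <= j%:R :> R by rewrite natr1 ler_nat.
  rewrite (psi_up Q) ?ler_wpM2r //; last by lra.
  rewrite {1}/psi /cell /= !(psi_up Q) ?le //; try lia.
  by case: ifP => _; rewrite /comb4 /= -!natr1; congr pair; ring.
- have ji' : j%:R + 1 <= i%:R :> R by rewrite natr1 ler_nat.
  rewrite (psi_low Q) ?ler_wpM2r //; last by lra.
  rewrite {1}/psi /cell /= !(psi_low Q) ?le //; try lia.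
  by case: ifP => _; rewrite /comb4 /= -!natr1; congr pair; ring.
- have [ts|st] := leP t s.
    rewrite (psi_low Q) ?ler_wpM2r // ?lerD2l // psi_low //.
    rewrite /cell /comb4 /= !mul0r !(psi_low Q) ?le //.
    by rewrite /comb4 /= -!natr1; congr pair; ring.
  rewrite (psi_up Q) ?ler_wpM2r // ?lerD2l ?(ltW st) // psi_up ?(ltW st) //.
  rewrite /cell /comb4 /= !mul0r !(psi_up Q) ?le //.
  by rewrite /comb4 /= -!natr1; congr pair; ring.
Qed.

(** The self-similarity: subdividing a cell yields cells of the finer grid. *)
Lemma cell_cell Q N m C p : (p.1 < m)%N -> (p.2 < m)%N ->
  cell (cell Q N C) m p = cell Q (N * m) (subcell m C p).
Proof.
case: C p => [I J] [i j] /= im jm.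
have m0 : 0 < m%:R :> R by rewrite ltr0n; lia.
have frac01 k : (k <= m)%N -> 0 <= (k%:R / m%:R : R) <= 1.
  by move=> km; rewrite divr_ge0 //= ler_pdivrMr // mul1r ler_nat.
have coord K k : (K%:R + k%:R / m%:R) / N%:R = (K * m + k)%:R / (N * m)%:R :> R.
  rewrite natrD !natrM invfM; move: (N%:R^-1) => n.
  by field; rewrite gt_eqF.
by rewrite {1}/cell /= !psi_cell ?frac01 //; [rewrite !coord !addnS | lia..].
Qed.

(** In [psi Q s t] the weights satisfy s = a2 + a3 and t = a3 + a4, so the vertex R1 of S_m(k) sits
    at the lower left corner of the stated cell. The families A1, A2, A3 are the cells below, above
    and on the diagonal. *)
Lemma Sm_cell Q m k : inA m k -> (0 < m)%N ->
  Sm Q m k = cell Q m (k2 k + k3 k, k3 k + k4 k)%N.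
Proof.
case: k => [[[a b] c] d] Ak m0; have m0' : m%:R != 0 :> R by rewrite pnatr_eq0 -lt0n.
have eqm : m%:R = (a + b + c + d)%:R + 1 :> R.
  by rewrite natr1; congr _%:R; case: Ak => [|[]]; rewrite /inA1 /inA2 /inA3 /k1 /k2 /k3 /k4 /=; lia.
have ge0 : 0 <= (m%:R : R)^-1 by rewrite invr_ge0.
have le x y : (x <= y)%N -> (x%:R / m%:R <= y%:R / m%:R :> R).
  by move=> xy; rewrite ler_wpM2r // ler_nat.
rewrite /Sm /cell /k1 /k2 /k3 /k4 /=.
have fin x y : x * m%:R = y * m%:R -> x = y :> R by move/mulIf; apply.
case: Ak => [|[]]; rewrite /inA1 /inA2 /inA3 /k1 /k2 /k3 /k4 /=.
- move=> [d0 [sum b0]]; subst d; move/eqP: (b0) => ->.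
  rewrite !psi_low ?le //; try lia.
  by congr Quad; rewrite /comb4 -?natr1 ?natrD; congr pair; apply: fin;
     rewrite !mulrDl; field : eqm.
- move=> [b0 [sum d0]]; subst b; move/eqP: (d0) => ->.
  rewrite !psi_up ?le //; try lia.
  by congr Quad; rewrite /comb4 -?natr1 ?natrD; congr pair; apply: fin;
     rewrite !mulrDl; field : eqm.
- move=> [b0 [d0 sum]]; subst b d; rewrite /= !addn0 add0n.
  rewrite (psi_up Q (_ : c%:R / _ <= c.+1%:R / _)) ?le // !psi_low ?le //.
  by congr Quad; rewrite /comb4 -?natr1 ?natrD; congr pair; apply: fin;
     rewrite !mulrDl; field : eqm.
Qed.

(** * Square coordinates on a convex quadrilateral *)

Section Convex.
Variable Q : quad R.
Hypothesis convQ : convex_quad_ccw Q.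

Let A := orient (qv2 Q) (qv3 Q) (qv4 Q).
Let B := orient (qv3 Q) (qv4 Q) (qv1 Q).
Let C := orient (qv4 Q) (qv1 Q) (qv2 Q).
Let D := orient (qv1 Q) (qv2 Q) (qv3 Q).

Let A0 : 0 < A. Proof. by case: convQ => _ []. Qed.
Let B0 : 0 < B. Proof. by case: convQ => _ [] _ []. Qed.
Let C0 : 0 < C. Proof. by case: convQ => _ [] _ []. Qed.
Let D0 : 0 < D. Proof. by case: convQ. Qed.

(* The affine dependence A Q1 + C Q3 = B Q2 + D Q4, with A + C = B + D, trades
   weight on one of Q2, Q4 against weight on Q1 and Q3. *)
Lemma psi_surj x : region Q x ->
  exists s t, [/\ 0 <= s <= 1, 0 <= t <= 1 & x = psi Q s t].
Proof.
move=> [b1 [b2 [b3 [b4 [b1_0 [b2_0 [b3_0 [b4_0 [sum ->]]]]]]]]].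
have ABCD : A + C = B + D by rewrite /A /B /C /D /orient; ring.
have A_0 := ltW A0; have B_0 := ltW B0; have C_0 := ltW C0; have D_0 := ltW D0.
have trade r : comb4 b1 b2 b3 b4 Q =
    comb4 (b1 + r * A) (b2 - r * B) (b3 + r * C) (b4 - r * D) Q.
  by rewrite /comb4 /A /B /C /D /orient; congr pair; ring.
(* The smaller ratio is the largest trade keeping both weights nonnegative; it removes Q2 in the
   first case and Q4 in the second. *)
have [le24|/ltW le42] := leP (b2 / B) (b4 / D).
- pose r := b2 / B; have r0 : 0 <= r by exact: divr_ge0.
  have rB : r * B = b2 by rewrite /r divfK // gt_eqF.
  have rD : r * D <= b4 by rewrite -ler_pdivlMr.
  have rA : 0 <= r * A by exact: mulr_ge0.
  have rC : 0 <= r * C by exact: mulr_ge0.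
  have rS : r * A + r * C = b2 + r * D by rewrite -mulrDr ABCD mulrDr rB.
  exists (b3 + r * C), (b3 + r * C + b4 - r * D); split; [apply/andP; split; lra..|].
  rewrite psi_up; last by lra.
  by rewrite (trade r) rB; congr comb4; lra.
- pose r := b4 / D; have r0 : 0 <= r by exact: divr_ge0.
  have rD : r * D = b4 by rewrite /r divfK // gt_eqF.
  have rB : r * B <= b2 by rewrite -ler_pdivlMr.
  have rA : 0 <= r * A by exact: mulr_ge0.
  have rC : 0 <= r * C by exact: mulr_ge0.
  have rS : r * A + r * C = r * B + b4 by rewrite -mulrDr ABCD mulrDr rD.
  exists (b3 + r * C + b2 - r * B), (b3 + r * C); split; [apply/andP; split; lra..|].
  rewrite psi_low; last by lra.
  by rewrite (trade r) rD; congr comb4; lra.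
Qed.

(* On Q the signed area [orient Q1 Q3] is -D a2 on Delta1 and B a4 on Delta2, and
   [orient Q1 Q2] is D a3 + C a4. *)
Definition area13 (x : pt R) := orient (qv1 Q) (qv3 Q) x.
Definition coord2 x := (`|area13 x| - area13 x) / 2 / D.
Definition coord4 x := (`|area13 x| + area13 x) / 2 / B.
Definition coord3 x := (orient (qv1 Q) (qv2 Q) x - coord4 x * C) / D.
Definition ucoord x := coord2 x + coord3 x.
Definition vcoord x := coord3 x + coord4 x.

(** Up to scaling, [coord2] and [coord4] are the negative and positive parts of the signed area, so
    one continuous formula inverts [psi Q] on both triangles. *)
Lemma coords_psi s t : ucoord (psi Q s t) = s /\ vcoord (psi Q s t) = t.
Proof.
have Dn : D != 0 by rewrite gt_eqF.
have Bn : B != 0 by rewrite gt_eqF.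
suff [e2 e3 e4] : [/\ coord2 (psi Q s t) = Num.max (s - t) 0,
    coord3 (psi Q s t) = Num.min s t & coord4 (psi Q s t) = Num.max (t - s) 0].
  rewrite /ucoord /vcoord e2 e3 e4; have [st|/ltW ts] := leP s t.
    by rewrite max_r ?subr_le0 // max_l ?subr_ge0 //; split; lra.
  by rewrite max_l ?subr_ge0 // max_r ?subr_le0 //; split; lra.
have [ts|/ltW st] := leP t s.
- have e : area13 (psi Q s t) = - ((s - t) * D).
    by rewrite psi_low // /area13 /comb4 /D /orient /=; ring.
  have n : `|area13 (psi Q s t)| = (s - t) * D.
    by rewrite e normrN ger0_norm // mulr_ge0 ?(ltW D0) // subr_ge0.
  have e4 : coord4 (psi Q s t) = 0 by rewrite /coord4 n e subrr !mul0r.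
  have e3 : coord3 (psi Q s t) = t.
    rewrite /coord3 e4 mul0r subr0; apply: (mulIf Dn); rewrite divfK //.
    by rewrite psi_low // /comb4 /D /orient /=; ring.
  rewrite e3 e4 max_l ?subr_ge0 // max_r ?subr_le0 //; split=> //.
  by rewrite /coord2 n e; field.
- have e : area13 (psi Q s t) = (t - s) * B.
    by rewrite psi_up // /area13 /comb4 /B /orient /=; ring.
  have n : `|area13 (psi Q s t)| = (t - s) * B.
    by rewrite e ger0_norm // mulr_ge0 ?(ltW B0) // subr_ge0.
  have e4 : coord4 (psi Q s t) = t - s by rewrite /coord4 n e; field.
  rewrite e4 max_r ?subr_le0 // max_l ?subr_ge0 //; split=> //.
    by rewrite /coord2 n e subrr !mul0r.
  rewrite /coord3 e4; apply: (mulIf Dn); rewrite divfK //.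
  by rewrite psi_up // /comb4 /D /C /orient /=; ring.
Qed.

Lemma psi_inj s t s' t' : psi Q s t = psi Q s' t' -> s = s' /\ t = t'.
Proof.
move=> e; have [u v] := coords_psi s t; have [u' v'] := coords_psi s' t'.
by split; [rewrite -u e | rewrite -v e].
Qed.

Lemma Pmap_psi V s t : 0 <= s <= 1 -> 0 <= t <= 1 ->
  Pmap Q V (psi Q s t) (psi V s t).
Proof.
move=> /andP[s0 s1] /andP[t0 t1]; have [ts|st] := leP t s.
  exists (1 - s), (s - t), t, 0; rewrite !psi_low //; split => //.
  by left; do !split => //; lra.
exists (1 - t), 0, s, (t - s); rewrite [psi V _ _]psi_up ?(ltW st) //; split => //.
(* It remains to see that the point is not in Delta1. Barycentric coordinates there would give it
   square coordinates (b2 + b3, b3), against s < t. *)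
right; split; last by rewrite psi_up ?(ltW st) //; do !split => //; lra.
move=> [b1 [b2 [b3 [b1_0 [b2_0 [b3_0 [sum e]]]]]]].
have : psi Q s t = psi Q (b2 + b3) b3.
  by rewrite e psi_low; [congr comb4; lra|lra].
by move/psi_inj => [es et]; lra.
Qed.

Lemma region_psi V s t : 0 <= s <= 1 -> 0 <= t <= 1 -> region V (psi V s t).
Proof.
move=> /andP[s0 s1] /andP[t0 t1]; have [ts|st] := leP t s.
  by rewrite psi_low //; exists (1 - s), (s - t), t, 0; do !split => //; lra.
by rewrite psi_up ?(ltW st) //; exists (1 - t), 0, s, (t - s); do !split => //; lra.
Qed.

Lemma coords_continuous : continuous ucoord /\ continuous vcoord.
Proof.
have c1 : continuous (fun x : pt R => x.1) by move=> x; exact: cvg_fst.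
have c2 : continuous (fun x : pt R => x.2) by move=> x; exact: cvg_snd.
have cB (f g : pt R -> R) : continuous f -> continuous g ->
    continuous (fun x => f x - g x) by move=> cf cg x; apply: continuousB; [exact: cf|exact: cg].
have cD (f g : pt R -> R) : continuous f -> continuous g ->
    continuous (fun x => f x + g x) by move=> cf cg x; apply: continuousD; [exact: cf|exact: cg].
have cM (f g : pt R -> R) : continuous f -> continuous g ->
    continuous (fun x => f x * g x) by move=> cf cg x; apply: continuousM; [exact: cf|exact: cg].
have cK (k : R) : continuous (fun _ : pt R => k) by move=> x; exact: cst_continuous.
have corient p q : continuous (fun x => orient p q x : R).
  by rewrite /orient; apply: (cB); apply: (cM) => //; apply: (cB).
have carea : continuous area13 by exact: corient.
have cnorm : continuous (fun x => `|area13 x| : R).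
  by move=> x; apply: cvg_norm; exact: carea.
have c_2 : continuous coord2 by do 2![apply: (cM) => //]; apply: (cB).
have c_4 : continuous coord4 by do 2![apply: (cM) => //]; apply: (cD).
have c_3 : continuous coord3 by apply: (cM) => //; apply: (cB) => //; apply: (cM).
by split; apply: (cD).
Qed.
End Convex.
End Geometry.

(** * The labyrinth fractal *)

Section Fractal.
Local Set Implicit Arguments.
Local Unset Strict Implicit.
Variables (R : realType) (Q : quad R).
Hypothesis convQ : convex_quad_ccw Q.

Lemma psi_corners :
  [/\ qv1 Q = psi Q 0 0, qv2 Q = psi Q 1 0, qv3 Q = psi Q 1 1 & qv4 Q = psi Q 0 1].
Proof.
rewrite !(psi_low Q (lexx _)) (psi_low Q ler01) (psi_up Q ler01) /comb4.
case: Q => [[a1 a2] [b1 b2] [c1 c2] [d1 d2]] /=.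
by split; congr pair; ring.
Qed.

Lemma gridpoint_inj N a b c d : (0 < N)%N ->
  psi Q (a%:R / N%:R) (b%:R / N%:R) = psi Q (c%:R / N%:R) (d%:R / N%:R) ->
  a = c /\ b = d.
Proof.
move=> N0 /(psi_inj convQ)[]; have Nn : (N%:R : R)^-1 != 0 by rewrite invr_eq0 pnatr_eq0 -lt0n.
by move=> /(mulIf Nn)/eqP + /(mulIf Nn)/eqP; rewrite !eqr_nat => /eqP -> /eqP ->.
Qed.

Lemma cell_inj N c c' : (0 < N)%N -> cell Q N c = cell Q N c' -> c = c'.
Proof.
case: c c' => [i j] [i' j'] N0 /(congr1 (@qv1 R)) /=.
by move=> e; have [-> ->] := gridpoint_inj N0 e.
Qed.

Lemma common_side_adj4 N c c' : (0 < N)%N ->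
  common_side (cell Q N c) (cell Q N c') -> adj4 c c'.
Proof.
case: c c' => [i j] [i' j'] N0 [neq [a [b [sab sab']]]].
have nc : i = i' -> j = j' -> False by move=> ei ej; apply: neq; rewrite ei ej.
rewrite /adj4 /=.
(* Each way of matching a side of one cell with a side of the other, in either direction, equates
   two pairs of grid points, which decides the relative position of the cells. *)
by case: sab sab' => [|[|[|]]] [-> ->] {neq} [] [|[|[|]]] [];
  rewrite /= => h1 h2; have [e1 e2] := gridpoint_inj N0 h1; have [e3 e4] := gridpoint_inj N0 h2;
  first [exfalso; apply: nc; lia | lia].
Qed.

Lemma gridsquare_region N c x : (0 < N)%N -> region Q x ->
  gridsquare N c (ucoord Q x) (vcoord Q x) -> region (cell Q N c) x.
Proof.
move=> N0 /(psi_surj convQ)[s [t [_ _ ->]]].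
have [-> ->] := coords_psi convQ s t.
have N0' : 0 < N%:R :> R by rewrite ltr0n.
have Nn : N%:R != 0 :> R by rewrite gt_eqF.
rewrite /gridsquare !ler_pdivrMr // !ler_pdivlMr // -!natr1.
move=> [/andP[s0 s1] /andP[t0 t1]].
have -> : psi Q s t = psi (cell Q N c) (s * N%:R - c.1%:R) (t * N%:R - c.2%:R).
  rewrite psi_cell; [|apply/andP; split; lra..].
  by congr psi; field.
by apply: region_psi; apply/andP; split; lra.
Qed.

(** Weights on four vertices are not unique, so only some convex representation with bounded weights
    is required; this makes the condition convex in [x]. *)
Definition weights_le (M1 M2 M3 M4 : R) (x : pt R) :=
  exists a1 a2 a3 a4, [/\ [/\ 0 <= a1, 0 <= a2, 0 <= a3 & 0 <= a4],
    [/\ a1 <= M1, a2 <= M2, a3 <= M3 & a4 <= M4],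
    a1 + a2 + a3 + a4 = 1 & x = comb4 a1 a2 a3 a4 Q].

Lemma weights_le_region M1 M2 M3 M4 V x : region V x ->
  weights_le M1 M2 M3 M4 (qv1 V) -> weights_le M1 M2 M3 M4 (qv2 V) ->
  weights_le M1 M2 M3 M4 (qv3 V) -> weights_le M1 M2 M3 M4 (qv4 V) ->
  weights_le M1 M2 M3 M4 x.
Proof.
move=> [b1 [b2 [b3 [b4 [b1_0 [b2_0 [b3_0 [b4_0 [bsum ->]]]]]]]]] {x}.
move=> [p1 [p2 [p3 [p4 [[? ? ? ?] [? ? ? ?] psum ep]]]]].
move=> [q1 [q2 [q3 [q4 [[? ? ? ?] [? ? ? ?] qsum eq_]]]]].
move=> [r1 [r2 [r3 [r4 [[? ? ? ?] [? ? ? ?] rsum er]]]]].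
move=> [s1 [s2 [s3 [s4 [[? ? ? ?] [? ? ? ?] ssum es]]]]].
pose avg x y z w := b1 * x + b2 * y + b3 * z + b4 * w.
have avg0 x y z w : 0 <= x -> 0 <= y -> 0 <= z -> 0 <= w -> 0 <= avg x y z w.
  by move=> *; rewrite !addr_ge0 // mulr_ge0.
have avg_le M x y z w : x <= M -> y <= M -> z <= M -> w <= M -> avg x y z w <= M.
  move=> *; have -> : M = avg M M M M by rewrite /avg -!mulrDl bsum mul1r.
  by rewrite !lerD // ler_wpM2l.
exists (avg p1 q1 r1 s1), (avg p2 q2 r2 s2), (avg p3 q3 r3 s3), (avg p4 q4 r4 s4).
split; [split; exact: avg0|split; exact: avg_le| |].
  transitivity (avg (p1 + p2 + p3 + p4) (q1 + q2 + q3 + q4)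
                    (r1 + r2 + r3 + r4) (s1 + s2 + s3 + s4)); first by rewrite /avg; ring.
  by rewrite psum qsum rsum ssum /avg !mulr1.
by rewrite {1}/comb4 ep eq_ er es /comb4 /avg /=; congr pair; ring.
Qed.

Lemma Sm_weights_le m k x : (0 < m)%N -> inA m k -> region (Sm Q m k) x ->
  weights_le ((k1 k).+1%:R / m%:R) ((k2 k).+1%:R / m%:R)
             ((k3 k).+1%:R / m%:R) ((k4 k).+1%:R / m%:R) x.
Proof.
case: k => [[[a b] c] d] m0 Ak Sx.
have m0' : 0 < m%:R :> R by rewrite ltr0n.
have suml : a%:R / m%:R + b%:R / m%:R + c%:R / m%:R + d%:R / m%:R = 1 - m%:R^-1 :> R.
  have -> : m = (a + b + c + d).+1.
    by case: Ak => [|[]]; rewrite /inA1 /inA2 /inA3 /k1 /k2 /k3 /k4 /=; lia.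
  by rewrite -natr1 !natrD; field; rewrite -!natrD natr1 pnatr_eq0.
have h0 : 0 < (m%:R : R)^-1 by rewrite invr_gt0.
have ge0 j : 0 <= (j%:R / m%:R : R) by rewrite divr_ge0.
have inv_le j : (0 < j)%N -> (m%:R : R)^-1 <= j%:R / m%:R.
  by move=> j0; rewrite ler_peMl ?(ltW h0) // ler1n.
have [a0 b0 c0 d0] := And4 (ge0 a) (ge0 b) (ge0 c) (ge0 d).
have vertex a1 a2 a3 a4 : 0 <= a1 <= a.+1%:R / m%:R -> 0 <= a2 <= b.+1%:R / m%:R ->
    0 <= a3 <= c.+1%:R / m%:R -> 0 <= a4 <= d.+1%:R / m%:R -> a1 + a2 + a3 + a4 = 1 ->
    weights_le (a.+1%:R / m%:R) (b.+1%:R / m%:R) (c.+1%:R / m%:R) (d.+1%:R / m%:R)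
      (comb4 a1 a2 a3 a4 Q).
  by move=> /andP[? ?] /andP[? ?] /andP[? ?] /andP[? ?] e; exists a1, a2, a3, a4.
rewrite /k1 /k2 /k3 /k4 /=; move: Sx; rewrite /Sm /k1 /k2 /k3 /k4 /=.
case: Ak => [|[]]; rewrite /inA1 /inA2 /inA3 /k1 /k2 /k3 /k4 /=.
- move=> [d_0 [_ /eqP b_n]]; rewrite b_n; have b1 := inv_le b; rewrite lt0n b_n in b1.
  have {}b1 := b1 isT; subst d.
  by move/weights_le_region; apply; apply: vertex; rewrite -?natr1; lra.
- move=> [b_0 [_ /eqP d_n]]; rewrite d_n; have d1 := inv_le d; rewrite lt0n d_n in d1.
  have {}d1 := d1 isT; subst b.
  by move/weights_le_region; apply; apply: vertex; rewrite -?natr1; lra.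
- move=> [b_0 [d_0 _]]; subst b d.
  by move/weights_le_region; apply; apply: vertex; rewrite -?natr1; lra.
Qed.

(** A vertex of Q is extreme, so its own weight must reach 1. On S_m(k) that weight is at most (k_i
    + 1)/m, hence k_i is already the full sum m - 1. *)
Lemma corner_cell m k : (0 < m)%N -> inA m k ->
  [/\ region (Sm Q m k) (qv1 Q) -> k = mk4 m.-1 0 0 0,
      region (Sm Q m k) (qv2 Q) -> k = mk4 0 m.-1 0 0,
      region (Sm Q m k) (qv3 Q) -> k = mk4 0 0 m.-1 0 &
      region (Sm Q m k) (qv4 Q) -> k = mk4 0 0 0 m.-1].
Proof.
case: k => [[[a b] c] d] m0 Ak.
have sum : (a + b + c + d = m.-1)%N.
  by case: Ak => [|[]]; rewrite /inA1 /inA2 /inA3 /k1 /k2 /k3 /k4 /=; lia.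
have large j : 1 <= (j.+1%:R / m%:R : R) -> (m.-1 <= j)%N.
  by rewrite ler_pdivlMr ?ltr0n // mul1r ler_nat; lia.
have idx1 : (m.-1 <= a)%N -> (a, b, c, d) = mk4 m.-1 0 0 0.
  by rewrite /mk4 => ?; congr (_, _, _, _); lia.
have idx2 : (m.-1 <= b)%N -> (a, b, c, d) = mk4 0 m.-1 0 0.
  by rewrite /mk4 => ?; congr (_, _, _, _); lia.
have idx3 : (m.-1 <= c)%N -> (a, b, c, d) = mk4 0 0 m.-1 0.
  by rewrite /mk4 => ?; congr (_, _, _, _); lia.
have idx4 : (m.-1 <= d)%N -> (a, b, c, d) = mk4 0 0 0 m.-1.
  by rewrite /mk4 => ?; congr (_, _, _, _); lia.
have [pos123 [pos234 [pos341 pos412]]] := convQ.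
have affine p q a1 a2 a3 a4 : a1 + a2 + a3 + a4 = 1 ->
    orient p q (comb4 a1 a2 a3 a4 Q) = a1 * orient p q (qv1 Q) + a2 * orient p q (qv2 Q) +
      a3 * orient p q (qv3 Q) + a4 * orient p q (qv4 Q).
  move=> asum; have -> : a1 = 1 - a2 - a3 - a4 by lra.
  by rewrite /orient /comb4 /=; ring.
have rot p q r : orient q r p = orient p q r :> R by rewrite /orient; ring.
have swap p q r : orient p r q = - orient p q r :> R by rewrite /orient; ring.
have degen p q : orient p q p = 0 :> R by rewrite /orient; ring.
have degen' p q : orient p q q = 0 :> R by rewrite /orient; ring.
(* A convex combination attaining the maximum of an affine function that is
   positive at one vertex, zero at its neighbours and negative opposite. *)
have extreme (h h' w w' M : R) : 0 < h -> 0 < h' -> w <= M -> 0 <= w' ->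
    h = w * h - w' * h' -> 1 <= M.
  move=> h0 h'0 wM w'0 eh; apply: le_trans wM.
  by rewrite -(ler_pM2r h0) mul1r {1}eh gerBl mulr_ge0 // ltW.
split=> /(Sm_weights_le m0 Ak)[a1 [a2 [a3 [a4 [[a1_0 a2_0 a3_0 a4_0] [l1 l2 l3 l4] asum e]]]]].
(* For Q1 and Q3 the affine function vanishes on the diagonal Q2Q4, for Q2 and Q4 on Q1Q3. *)
- have eh : orient (qv4 Q) (qv1 Q) (qv2 Q) =
      a1 * orient (qv4 Q) (qv1 Q) (qv2 Q) - a3 * orient (qv2 Q) (qv3 Q) (qv4 Q).
    have := affine (qv2 Q) (qv4 Q) _ _ _ _ asum; rewrite -e degen degen'.
    by rewrite -(rot (qv2 Q) (qv4 Q) (qv1 Q)) (swap (qv2 Q) (qv3 Q) (qv4 Q)) => h;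
       rewrite [LHS]h; ring.
  exact/idx1/large/(extreme _ _ _ _ _ pos412 pos234 l1 a3_0 eh).
- have eh : orient (qv1 Q) (qv2 Q) (qv3 Q) =
      a2 * orient (qv1 Q) (qv2 Q) (qv3 Q) - a4 * orient (qv3 Q) (qv4 Q) (qv1 Q).
    have := affine (qv3 Q) (qv1 Q) _ _ _ _ asum; rewrite -e degen degen'.
    by rewrite -(rot (qv3 Q) (qv1 Q) (qv2 Q)) (swap (qv3 Q) (qv4 Q) (qv1 Q)) => h;
       rewrite [LHS]h; ring.
  exact/idx2/large/(extreme _ _ _ _ _ pos123 pos341 l2 a4_0 eh).
- have eh : orient (qv2 Q) (qv3 Q) (qv4 Q) =
      a3 * orient (qv2 Q) (qv3 Q) (qv4 Q) - a1 * orient (qv4 Q) (qv1 Q) (qv2 Q).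
    have := affine (qv4 Q) (qv2 Q) _ _ _ _ asum; rewrite -e degen degen'.
    by rewrite -(rot (qv4 Q) (qv2 Q) (qv3 Q)) (swap (qv4 Q) (qv1 Q) (qv2 Q)) => h;
       rewrite [LHS]h; ring.
  exact/idx3/large/(extreme _ _ _ _ _ pos234 pos412 l3 a1_0 eh).
- have eh : orient (qv3 Q) (qv4 Q) (qv1 Q) =
      a4 * orient (qv3 Q) (qv4 Q) (qv1 Q) - a2 * orient (qv1 Q) (qv2 Q) (qv3 Q).
    have := affine (qv1 Q) (qv3 Q) _ _ _ _ asum; rewrite -e degen degen'.
    by rewrite -(rot (qv1 Q) (qv3 Q) (qv4 Q)) (swap (qv1 Q) (qv2 Q) (qv3 Q)) => h;
       rewrite [LHS]h; ring.
  exact/idx4/large/(extreme _ _ _ _ _ pos341 pos123 l4 a2_0 eh).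
Qed.

(** * From the labyrinth set to the pattern and its limit *)

Section Labyrinth.
Variables (m : nat) (W1 : set (quad R)).
Hypothesis labW1 : labyrinth_set Q m W1.

Let m_ge4 : (4 <= m)%N. Proof. by case: labW1. Qed.
Let m_gt0 : (0 < m)%N. Proof. by apply: leq_trans m_ge4. Qed.

Definition base : pred cellidx :=
  fun c => [&& (c.1 < m)%N, (c.2 < m)%N & `[< W1 (cell Q m c) >]].

Lemma base_lt c : base c -> (c.1 < m)%N /\ (c.2 < m)%N.
Proof. by case/and3P. Qed.

Lemma base_Sm k : inA m k -> W1 (Sm Q m k) -> base (k2 k + k3 k, k3 k + k4 k)%N.
Proof.
move=> Ak; rewrite Sm_cell // => Wk; apply/and3P; split; last exact/asboolP.
- by case: Ak => [|[]]; rewrite /inA1 /inA2 /inA3 /=; lia.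
- by case: Ak => [|[]]; rewrite /inA1 /inA2 /inA3 /=; lia.
Qed.

Lemma W1_base W : W1 W -> exists2 c, base c & W = cell Q m c.
Proof.
case: labW1 => _ [sub _] W1W; have [k [Ak eW]] := sub _ W1W.
by exists (k2 k + k3 k, k3 k + k4 k)%N; [apply: base_Sm; rewrite // -eW|rewrite -Sm_cell].
Qed.

Lemma base_connected p q : base p -> base q -> walk base p q.
Proof.
move=> Hp Hq; have [_ [_ [[_ [conn _]] _]]] := labW1.
have [/and3P[_ _ /asboolP Wp] /and3P[_ _ /asboolP Wq]] := (Hp, Hq).
have [n [P [P0 [Pn [PV Padj]]]]] := conn _ _ Wp Wq.
elim: n p P P0 Pn PV Padj Hp {Wp} => [|n IH] p P P0 Pn PV Padj Hp.
  by exists [::]; split=> //=; [apply: (cell_inj m_gt0); rewrite -P0 -Pn|rewrite Hp].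
have [c Hc ec] := W1_base (PV 1%N isT).
apply: walk_cat (walk_step Hp Hc _) _.
  by apply: (common_side_adj4 m_gt0); rewrite -P0 -ec; exact: Padj.
by apply: (IH c (P \o succn)) => // [i le_i|i lt_i]; [exact: PV|exact: Padj].
Qed.

(** In grid coordinates the exit property says that some column has both its bottom and top cell,
    and some row both its left and right cell. *)
Lemma base_exits : exists b d,
  [/\ base (b, 0%N), base (b, m.-1), base (0%N, d) & base (m.-1, d)].
Proof.
have [_ [_ [_ [[a [b [[Ab [Wb Wt]] _]]] [[a' [d [[Ad [Wl Wr]] _]]] _]]]]] := labW1.
have [eb ed] : (b + a = m.-1)%N /\ (a' + d = m.-1)%N.
  split; [case: Ab => [|[]]|case: Ad => [|[]]]; rewrite /inA1 /inA2 /inA3 /mk4 /k1 /k2 /k3 /k4 /=; lia.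
have At : inA m (mk4 0 0 b a) by rewrite /inA /inA1 /inA2 /inA3 /mk4 /k1 /k2 /k3 /k4 /=; lia.
have Ar : inA m (mk4 0 a' d 0) by rewrite /inA /inA1 /inA2 /inA3 /mk4 /k1 /k2 /k3 /k4 /=; lia.
exists b, d; split.
- by have := base_Sm Ab Wb; rewrite /k2 /k3 /k4 /= addn0.
- by have := base_Sm At Wt; rewrite /k2 /k3 /k4 /= add0n eb.
- by have := base_Sm Ad Wl; rewrite /k2 /k3 /k4 /= add0n.
- by have := base_Sm Ar Wr; rewrite /k2 /k3 /k4 /= addn0 ed.
Qed.

Let pat := pattern m base.

(** By [cell_cell], the subcell [p] of block [C] is the image of the base cell [p] under the map P_V
    for V the block. The exponent is n + 1 since [Wset] starts at the first level with index 0. *)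
Lemma pattern_Wset n c : pat n c -> Wset Q W1 n (cell Q (m ^ n.+1) c).
Proof.
have [b [d [Hb _ _ _]]] := base_exits.
elim: n c => [|n IH] c; first by case/and3P => _ _ /asboolP; rewrite expn1.
move=> /(pattern_subcellE)[C [p [GC Hp ->]]].
have /and3P[p1 p2 /asboolP Wp] := Hp.
exists (cell Q m p), (cell Q (m ^ n.+1) C); split=> //; split; first exact: IH.
rewrite (expnSr m n.+1) -cell_cell //.
have frac01 k : (k <= m)%N -> 0 <= (k%:R / m%:R : R) <= 1.
  by move=> km; rewrite divr_ge0 //= ler_pdivrMr ?ltr0n // mul1r ler_nat.
by do !split; apply: (Pmap_psi convQ); apply: frac01 => //; exact: ltnW.
Qed.

Lemma gridsquare_subcell N C p (s t : R) : (0 < N)%N -> base p ->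
  gridsquare (N * m) (subcell m C p) s t -> gridsquare N C s t.
Proof.
case: C p => [I J] [i j] N0 /base_lt[/= im jm].
have lo K k : (K%:R / N%:R <= (K * m + k)%:R / (N * m)%:R :> R).
  rewrite ler_pdivlMr ?ltr0n ?muln_gt0 ?N0 // natrM mulrA divfK ?pnatr_eq0 -?lt0n //.
  by rewrite -natrM ler_nat leq_addr.
have hi K k : (k < m)%N -> ((K * m + k).+1%:R / (N * m)%:R <= K.+1%:R / N%:R :> R).
  move=> km; rewrite ler_pdivrMr ?ltr0n ?muln_gt0 ?N0 // natrM mulrA divfK ?pnatr_eq0 -?lt0n //.
  by rewrite -natrM ler_nat mulSn; lia.
move=> [/andP[a1 a2] /andP[b1 b2]]; split; apply/andP; split.
- exact: le_trans (lo _ _) a1.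
- exact: le_trans a2 (hi _ _ im).
- exact: le_trans (lo _ _) b1.
- exact: le_trans b2 (hi _ _ jm).
Qed.

(** At each level a walk of the pattern across the square blocks K, so K meets the union of the
    pattern squares. These unions are closed and decreasing, and compactness gives a point of K in
    all of them. *)
Lemma compact_connected_meets_Linf (K : set (pt R)) :
  compact K -> connected K -> K `<=` region Q ->
  ((exists2 z, K z & ucoord Q z = 0) /\ (exists2 z, K z & ucoord Q z = 1)) \/
  ((exists2 z, K z & vcoord Q z = 0) /\ (exists2 z, K z & vcoord Q z = 1)) ->
  K `&` Linf Q W1 !=set0.
Proof.
move=> cK connK KQ ends.
have [cu cv] := coords_continuous Q.
have [b [d [Hb Ht Hl Hr]]] := base_exits.
have unitK z : K z -> 0 <= ucoord Q z <= 1 /\ 0 <= vcoord Q z <= 1.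
  by move=> /KQ/(psi_surj convQ)[s [t [? ? ->]]]; have [-> ->] := coords_psi convQ s t.
pose N n := (m ^ n.+1)%N.
have N0 n : (0 < N n)%N by rewrite expn_gt0 m_gt0.
have ltN n c : pat n c -> (c.1 < N n)%N /\ (c.2 < N n)%N := @pattern_lt m base b base_lt Hb n c.
pose E n := [set z | exists c, [/\ (c.1 < N n)%N, (c.2 < N n)%N, pat n c &
  gridsquare (N n) c (ucoord Q z) (vcoord Q z)]].
have meets n : K `&` E n !=set0.
  have conn p q : pat n p -> pat n q -> walk (pat n) p q.
    exact: (pattern_connected base_lt base_connected Hb Ht Hl Hr).
  suff [z Kz [c Gc zc]] : exists2 z, K z &
      exists2 c, pat n c & gridsquare (N n) c (ucoord Q z) (vcoord Q z).
    by have [c1 c2] := ltN _ _ Gc; exists z; split => //; exists c.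
  case: ends => -[z0 z1].
    have [x Gx] := pattern_bottom base_lt Hb n.
    have [y Gy] := pattern_top base_lt Hb Ht n.
    exact: (connected_meets_walk cu cv (N0 n) (ltN n) (conn _ _ Gx Gy)).
  have [x Gx] := pattern_left base_lt Hb Hl n.
  have [y Gy] := pattern_right base_lt Hb Hr n.
  (* A left-to-right walk is handled by exchanging the two coordinates. *)
  have [|z /unitK[]|z Kz [c Gc zc]] := connected_meets_walk cv cu (N0 n) _
      (walk_swap (conn _ _ Gx Gy)) connK _ z0 z1; [by case=> i j /ltN[]|by []|].
  by exists z => //; exists (c.2, c.1) => //; exact: gridsquare_swap zc.
have clE n : closed (E n) by exact: (closed_gridsquares cu cv).
have decE n : E n.+1 `<=` E n.
  move=> z [c [_ _ Gc zc]]; have [C [p [GC Hp ec]]] := pattern_subcellE Gc.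
  have [C1 C2] := ltN _ _ GC; exists C; split => //.
  by move: zc; rewrite /N (expnSr m n.+1) ec; exact: (gridsquare_subcell (N0 n) Hp).
have [z [Kz Ez]] := compact_nested cK clE decE meets.
exists z; split => // n _; have [c [_ _ Gc zc]] := Ez n I.
exists (cell Q (N n) c); first exact: pattern_Wset.
by apply: gridsquare_region zc => //; exact: KQ.
Qed.

(** Such a point is already missing from the first level, which has index 0. *)
Lemma corner_notin_Linf x k0 : (forall k, inA m k -> region (Sm Q m k) x -> k = k0) ->
  ~ W1 (Sm Q m k0) -> ~ Linf Q W1 x.
Proof.
move=> only nW /(_ 0%N I)[W W1W Wx]; have [_ [sub _]] := labW1.
by have [k [Ak eW]] := sub _ W1W; apply: nW; rewrite -(only k Ak) -?eW.
Qed.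

Lemma complement_not_path_connected : ~ path_connected (region Q `\` Linf Q W1).
Proof.
move=> pathQ.
have noPath p q : region Q p -> region Q q -> ~ Linf Q W1 p -> ~ Linf Q W1 q ->
    (ucoord Q p = 0 /\ ucoord Q q = 1) \/ (vcoord Q p = 0 /\ vcoord Q q = 1) -> False.
  move=> Qp Qq Lp Lq pq; have [f [cf [f0 [f1 fQ]]]] := pathQ p q (conj Qp Lp) (conj Qq Lq).
  have fp : (f @` `[0, 1]) p by exists 0; rewrite //= in_itv /= lexx ler01.
  have fq : (f @` `[0, 1]) q by exists 1; rewrite //= in_itv /= lexx ler01.
  have [||||z [/fQ[_ nLz] Lz]] := @compact_connected_meets_Linf (f @` `[0, 1]).
  - exact: continuous_compact cf (@segment_compact _ _ _).
  - exact: connected_continuous_connected (@segment_connected _ _ _) cf.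
  - by move=> z /fQ[].
  - by case: pq => -[p0 q1]; [left|right]; split; [exists p|exists q|exists p|exists q].
  - exact: nLz.
have [e1 e2 e3 e4] := psi_corners.
have reg s t : 0 <= s <= 1 -> 0 <= t <= 1 -> region Q (psi Q s t) by exact: region_psi.
have u0 : 0 <= (0 : R) <= 1 by rewrite lexx ler01.
have u1 : 0 <= (1 : R) <= 1 by rewrite lexx ler01.
have [_ [_ [_ [_ [_ [c13 c24]]]]]] := labW1.
have L1 : ~ W1 (Sm Q m (mk4 m.-1 0 0 0)) -> ~ Linf Q W1 (qv1 Q).
  by apply: corner_notin_Linf => k Ak; case: (corner_cell m_gt0 Ak).
have L2 : ~ W1 (Sm Q m (mk4 0 m.-1 0 0)) -> ~ Linf Q W1 (qv2 Q).
  by apply: corner_notin_Linf => k Ak; case: (corner_cell m_gt0 Ak).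
have L3 : ~ W1 (Sm Q m (mk4 0 0 m.-1 0)) -> ~ Linf Q W1 (qv3 Q).
  by apply: corner_notin_Linf => k Ak; case: (corner_cell m_gt0 Ak).
have L4 : ~ W1 (Sm Q m (mk4 0 0 0 m.-1)) -> ~ Linf Q W1 (qv4 Q).
  by apply: corner_notin_Linf => k Ak; case: (corner_cell m_gt0 Ak).
have [[u1' v1'] [u2 v2] [u3 v3] [u4 v4]] :=
  And4 (coords_psi convQ 0 0) (coords_psi convQ 1 0) (coords_psi convQ 1 1) (coords_psi convQ 0 1).
move: L1 L2 L3 L4; rewrite e1 e2 e3 e4 => L1 L2 L3 L4.
(* Each diagonal has an endpoint outside the fractal. Two vertices taken from different diagonals
   are neighbours, so they lie on opposite sides of the square in exactly one coordinate. *)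
move/not_andP: c13 => [/L1 n1|/L3 n3]; move/not_andP: c24 => [/L2 n2|/L4 n4].
- by apply: (noPath _ _ _ _ n1 n2); [exact: reg|exact: reg|left].
- by apply: (noPath _ _ _ _ n1 n4); [exact: reg|exact: reg|right].
- by apply: (noPath _ _ _ _ n2 n3); [exact: reg|exact: reg|right].
- by apply: (noPath _ _ _ _ n4 n3); [exact: reg|exact: reg|left].
Qed.

End Labyrinth.
End Fractal.

Theorem theorem4p3 (R : realType) (Q : quad R) (m : nat) (W1 : set (quad R)) :
  convex_quad_ccw Q -> shorter_diag13 Q ->
  (4 <= m)%N -> labyrinth_set Q m W1 ->
  ~ path_connected (region Q `\` Linf Q W1).
Proof.
by move=> convQ _ _ labW1; exact: (complement_not_path_connected convQ labW1).
Qed.
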